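(* Let $X$ and $Y$ be Hausdorff spaces and let $f:X\to Y$ be a continuous surjection that is closed and sequence-covering. If $X$ has a $\sigma$-point-discrete $k$-network, then $Y$ has a $\sigma$-point-discrete $k$-network.
   Context: A family $\{B_\alpha:\alpha\in H\}$ of subsets of a space $X$ is *point-discrete* (also called weakly hereditarily closure-preserving) if $\{x_\alpha:\alpha\in H\}$ is closed discrete in $X$ whenever $x_\alpha\in B_\alpha$ for each $\alpha\in H$. A family is *$\sigma$-point-discrete* if it is a countable union of point-discrete families. A family $\mathcal P$ of subsets of $X$ is a *$k$-network* for $X$ if whenever $K$ is a compact subset of $X$ and $K\subset U$ with $U$ open in $X$, there is a finite subfamily $\mathcal P'\subset\mathcal P$ such that $K\subset\bigcup\mathcal P'\subset U$. A map $f:X\to Y$ is *sequence-covering* if whenever $\{y_n\}$ is a convergent sequence in $Y$ there is a convergent sequence $\{x_n\}$ in $X$ with $x_n\in f^{-1}(y_n)$ for each $n$. *)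

(* Defs.v *)
From HB Require Import structures.
From mathcomp Require Import all_boot all_order all_algebra.
From mathcomp Require Import all_classical all_reals all_analysis.

Set Implicit Arguments.
Unset Strict Implicit.
Unset Printing Implicit Defensive.

Local Open Scope classical_set_scope.

(* [isolated A] is the set of points of [A] isolated in the subspace [A], so
   the inclusion says that the subspace topology on [A] is discrete. *)
Definition closed_discrete (X : topologicalType) (A : set X) : Prop :=
  closed A /\ A `<=` isolated A.

(* Points are selected from the nonempty members only; otherwise adjoining the
   empty set would make every family point-discrete vacuously. *)
Definition point_discrete (X : topologicalType) (I : Type) (H : set I)
    (B : I -> set X) : Prop :=
  let H' := [set i | H i /\ B i !=set0] in
  forall x : I -> X, (forall i, H' i -> B i (x i)) -> closed_discrete (x @` H').

Definition sigma_point_discrete (X : topologicalType)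
    (P : set (set X)) : Prop :=
  exists F : nat -> set (set X),
    P = \bigcup_n F n /\ forall n, point_discrete (F n) id.

Definition k_network (X : topologicalType) (P : set (set X)) : Prop :=
  forall K U : set X, compact K -> open U -> K `<=` U ->
    exists P' : set (set X),
      [/\ finite_set P', P' `<=` P,
          K `<=` \bigcup_(B in P') B & \bigcup_(B in P') B `<=` U].

Definition closed_map (X Y : topologicalType) (f : X -> Y) : Prop :=
  forall A : set X, closed A -> closed (f @` A).

Definition convergent_seq (X : topologicalType) (u : nat -> X) : Prop :=
  exists l : X, u @ \oo --> l.

Definition sequence_covering (X Y : topologicalType) (f : X -> Y) : Prop :=
  forall y : nat -> Y, convergent_seq y ->
    exists x : nat -> X, convergent_seq x /\ forall n, f (x n) = y n.

(* Main.v *)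
(** The witness is the family Q of images f(B) of the members B of the given
    k-network P.  A set is closed discrete iff all its subsets are closed, so
    closed maps preserve closed discrete selections and Q is
    sigma-point-discrete.  On a compact K a point-discrete family leaves only
    countably many traces: otherwise one could choose infinitely many distinct
    points of K from distinct members, an infinite closed discrete subset
    of K.  Since Q is a network for points, K has a countable network, and
    sequences in K have convergent subsequences.  If no finite subfamily of
    the members of Q inside U covered K, take y_n in K outside the first n of
    their traces; lift a convergent subsequence of y_n to X.  A tail of the
    lift together with its limit is compact, so finitely many members of P
    cover it inside the preimage of U, and their images have finitely many
    traces on K, a contradiction. *)

Require Import Defs.
From HB Require Import structures.
From mathcomp Require Import all_boot all_order all_algebra.
From mathcomp Require Import all_classical all_reals all_analysis.

Local Open Scope classical_set_scope.

Lemma closed_discrete_subset_closed (X : topologicalType) (A B : set X) :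
  closed_discrete A -> B `<=` A -> closed B.
Proof.
move=> [Acl Aiso] BA p clBp.
have Ap : A p by apply: Acl => V /clBp [q [/BA Aq Vq]]; exists q.
have [_ [V Vp VA]] := Aiso p Ap.
have [q [Bq Vq]] := clBp V Vp.
have : (V `&` A) q by split => //; exact: BA.
by rewrite VA => <-.
Qed.

Lemma subset_closed_closed_discrete (X : topologicalType) (A : set X) :
  (forall B, B `<=` A -> closed B) -> closed_discrete A.
Proof.
move=> Asub; split=> [|p Ap]; first exact: Asub.
split; first exact: mem_set.
exists (~` (A `\ p)).
  apply: open_nbhs_nbhs; split; last by move=> [_]; apply.
  by apply: closed_openC; apply: Asub => q [].
rewrite predeqE => q; split => [[nq Aq]|/= ->].
  by apply: contrapT => qp; apply: nq.
by split => // -[_]; apply.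
Qed.

(** A selection from the images lifts to a selection from [F]. Every set of selected values is then
    the image of a subset of the lifted points, closed because these are closed discrete. *)
Lemma point_discrete_image (X Y : topologicalType) (f : X -> Y)
    (F : set (set X)) :
  closed_map f -> set_surj [set: X] [set: Y] f ->
  point_discrete F id ->
  point_discrete [set f @` B | B in F] id.
Proof.
move=> f_closed f_surj Fpd H' y yP.
have [x0 _ _] := f_surj (y set0) I.
have selP (B : set X) : exists x, F B /\ B !=set0 -> B x /\ f x = y (f @` B).
  have [[FB [b Bb]]|nB] := pselect (F B /\ B !=set0); last by exists x0.
  have [|x Bx fx] := yP (f @` B); last by exists x.
  by split; [exists B | exists (f b); exists b].
have [sel {}selP] := choice selP.
have /closed_discrete_subset_closed selcl :
    closed_discrete (sel @` [set B | F B /\ B !=set0]).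
  by apply: Fpd => B /selP [].
apply: subset_closed_closed_discrete => S SH.
pose A := (sel @` [set B | F B /\ B !=set0]) `&` f @^-1` S.
suff -> : S = f @` A by apply: f_closed; apply: selcl => x [].
rewrite predeqE => z; split => [Sz|[x [_ ? <-]] //].
have [C [[B FB <-] [_ [b Bb _]]] yz] := SH z Sz.
have HB : F B /\ B !=set0 by split => //; exists b.
have [_ fsel] := selP B HB.
by exists (sel B); [split; [exists B | rewrite /= fsel yz] | rewrite fsel].
Qed.

Lemma compact_seq_cluster (X : topologicalType) (K : set X) (u : nat -> X) :
  compact K -> (forall n, K (u n)) ->
  exists2 p, K p & forall W N, nbhs p W -> exists2 n, (N <= n)%N & W (u n).
Proof.
move=> Kc Ku; have [|p [Kp pcl]] := Kc (u @ \oo) _.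
  by exists 0%N => // n _.
exists p => // W N Wp.
have [|_ [[n Nn <-] Wn]] := pcl (u @` [set n | (N <= n)%N]) W _ Wp.
  by exists N => // n Nn; exists n.
by exists n.
Qed.

(** If a filter does not cluster at [l], some member of it misses a neighbourhood of [l], which
    leaves only finitely many terms of [u]. The set [D] allows passing to a tail. *)
Lemma cvg_seq_compact (X : topologicalType) (u : nat -> X) (l : X)
    (D : set nat) :
  u @ \oo --> l -> compact (l |` u @` D).
Proof.
move=> ul F PF FK; have [lcl|] := pselect (cluster F l).
  by exists l; split => //; left.
move/existsNP => [A] /existsNP [W] /not_implyP [FA] /not_implyP [Wl AW].
have [N _ NW] := ul W Wl.
have : compact ((l |` u @` D) `&` u @` [set n | (n < N)%N]).
  apply: finite_compact; apply: finite_setIr; apply: finite_image.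
  exact: finite_II.
move=> /(_ F PF) [|q [[Kq _] qcl]]; last by exists q.
apply: filterS (filterI FK FA) => q [Kq Aq]; split => //.
have nWq : ~ W q by move=> Wq; apply: AW; exists q.
case: Kq => [ql|[n Dn unq]].
  by case: nWq; rewrite ql; exact: nbhs_singleton.
exists n => //=; rewrite ltnNge; apply/negP => Nn.
by apply: nWq; rewrite -unq; exact: NW.
Qed.

Lemma point_discrete_compact_trace (X : topologicalType) (E : set (set X))
    (K : set X) :
  point_discrete E id -> compact K ->
  countable [set B `&` K | B in E].
Proof.
move=> Epd Kc; apply: contrapT => ncount.
(* If no new pair existed, each member of [E] would be listed in [s] or have its trace inside the
   finite set [D] of points already used. *)
have extend (s : seq (set X * X)) : exists Bx : set X * X,
    [/\ E Bx.1, Bx.1 Bx.2, K Bx.2,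
        Bx.1 \notin map fst s & Bx.2 \notin map snd s].
  apply: contrapT => nex; apply: ncount.
  pose D := [set x | x \in map snd s].
  pose T1 := [set B `&` K | B in [set B | B \in map fst s]].
  pose T2 := [set C | C `<=` D /\ finite_set C].
  have Dfin : finite_set D by exact: finite_seq.
  have cT : countable (T1 `|` T2).
    have -> : T1 `|` T2 = \bigcup_(b in [set: bool]) (if b then T1 else T2).
      rewrite predeqE => C; split => [[?|?]|[[] _ ?]].
      - by exists true.
      - by exists false.
      - by left.
      - by right.
    apply: bigcup_countable => // -[] _.
      by apply: finite_set_countable; apply: finite_image; exact: finite_seq.
    by apply: countable_finite_subset; exact: finite_set_countable.
  apply: sub_countable cT; apply: subset_card_le => _ [B EB <-].
  have [Bs|nBs] := boolP (B \in map fst s); first by left; exists B.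
  right; have BD : B `&` K `<=` D.
    move=> x [Bx Kx]; apply: contrapT => /negP nxs.
    by apply: nex; exists (B, x).
  by split => //; exact: sub_finite_set Dfin.
have [next nextP] := choice extend.
pose hist := fix hist n := if n is m.+1 then next (hist m) :: hist m else [::].
pose B n := (next (hist n)).1; pose x n := (next (hist n)).2.
have histP m n : (m < n)%N -> next (hist m) \in hist n.
  elim: n => // n IH; rewrite ltnS leq_eqVlt => /predU1P [->|/IH mn] /=.
    by rewrite inE eqxx.
  by rewrite inE mn orbT.
have injlt (T : eqType) (g : set X * X -> T) :
    (forall n, g (next (hist n)) \notin map g (hist n)) ->
    injective (fun n => g (next (hist n))).
  move=> gP m n; wlog mn : m n / (m < n)%N => [wl|].
    by case: (ltngtP m n) => // ? /esym e; [apply: wl|apply/esym/wl].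
  by move=> e; have := gP n; rewrite -e (map_f g (histP _ _ mn)).
have Binj : injective B by apply: (injlt _ fst) => n; have [] := nextP (hist n).
have xinj : injective x by apply: (injlt _ snd) => n; have [] := nextP (hist n).
have EB n : E (B n) by have [] := nextP (hist n).
have Bx n : B n (x n) by have [] := nextP (hist n).
have Kx n : K (x n) by have [] := nextP (hist n).
(* Injectivity of [B] makes the choice of [x n] in [B n] a single selection on [E]; other members
   get an arbitrary point. *)
have selP (C : set X) : exists z, E C /\ C !=set0 ->
    C z /\ forall n, C = B n -> z = x n.
  have [[n ->]|nC] := pselect (exists n, C = B n).
    by exists (x n) => _; split => // m /Binj ->.
  have [[_ [z Cz]]|nE] := pselect (E C /\ C !=set0); last by exists (x 0%N).
  by exists z => _; split => // n CB; case: nC; exists n.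
have [sel {}selP] := choice selP.
have [|Acl Aiso] := Epd sel; first by move=> C /selP [].
set A := sel @` _ in Acl Aiso.
have Ax n : A (x n).
  have HB : E (B n) /\ B n !=set0 by split => //; exists (x n).
  by exists (B n) => //; have [_] := selP _ HB; apply.
have [p Kp pcl] := compact_seq_cluster _ _ _ Kc Kx.
have Ap : A p by apply: Acl => V /(pcl _ 0%N) [n _ Vn]; exists (x n).
have [_ [V Vp VA]] := Aiso p Ap.
have xp N : exists2 n, (N <= n)%N & x n = p.
  have [n Nn Vn] := pcl V N Vp; exists n => //.
  have : (V `&` A) (x n) by split => //; exact: Ax.
  by rewrite VA.
have [n _ xn] := xp 0%N; have [m nm xm] := xp n.+1.
by move: nm; rewrite (xinj m n) ?ltnn // xm xn.
Qed.

(* A cluster point [p] of [y] is separated from any other point of [K] by one of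
   countably many open neighbourhoods of [p]; a subsequence that is eventually
   in each of these has no other cluster point in [K]. *)
Lemma countable_network_subsequence (Y : topologicalType)
    (Q : set (set Y)) (K : set Y) (y : nat -> Y) :
  hausdorff_space Y ->
  (forall U z, open U -> U z -> exists C, [/\ Q C, C z & C `<=` U]) ->
  countable [set C `&` K | C in Q] ->
  compact K -> (forall n, K (y n)) ->
  exists (p : Y) (s : nat -> nat),
    (forall n, (n <= s n)%N) /\ y \o s @ \oo --> p.
Proof.
move=> hY Qnet Qcount Kc Ky.
have [p Kp pcl] := compact_seq_cluster _ _ _ Kc Ky.
move/countable_injP : Qcount => [code codeinj].
pose separated j := exists C, [/\ Q C, code (C `&` K) = j &
  exists W V : set Y, [/\ open W, open V, W p, W `&` V = set0 & C `<=` V]].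
(* Members with the same code have the same trace on [K], so one witness serves them all. For other
   codes [(setT, set0)] imposes no constraint. *)
have WP (j : nat) : exists WV : set Y * set Y,
   [/\ open WV.1, open WV.2, WV.1 p, WV.1 `&` WV.2 = set0 &
   separated j ->
   forall C, Q C -> code (C `&` K) = j -> C `&` K `<=` WV.2].
  have [[C [QC Cj [W [V [oW oV Wp WV CV]]]]]|nex] := pselect (separated j);
    last first.
    exists (setT, set0).
    by split; rewrite ?setI0 //; [exact: openT|exact: open0].
  exists (W, V); split => // _ C' QC' C'j /=.
  have -> : C' `&` K = C `&` K.
    by apply: codeinj; rewrite ?C'j //; apply/mem_set; [exists C'|exists C].
  by move=> z [/CV].
have [WV {}WP] := choice WP.
have sP (n : nat) : exists m,
    (n <= m)%N /\ forall j, (j <= n)%N -> (WV j).1 (y m).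
  have [|m nm Wm] := pcl [set z | forall j : 'I_n.+1, (WV j).1 z] n.
    by apply: filter_forall => j; apply: open_nbhs_nbhs; have [] := WP j.
  by exists m; split => // j jn; exact: (Wm (Ordinal (jn : (j < n.+1)%N))).
have [s {}sP] := choice sP.
exists p, s; split => [n|]; first by have [] := sP n.
move=> U; rewrite nbhsE => -[G [oG Gp] GU].
apply: contrapT => nU.
(* Otherwise a further subsequence avoids [G] and clusters at some [q] other than [p]. *)
have mP (n : nat) : exists m, (n <= m)%N /\ ~ G (y (s m)).
  apply: contrapT => nex; apply: nU; exists n => // m /= nm; apply: GU.
  by apply: contrapT => nG; apply: nex; exists m.
have [m {}mP] := choice mP.
have [q Kq qcl] := compact_seq_cluster _ _ (y \o s \o m) Kc (fun n => Ky _).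
have nGq : ~ G q.
  move=> Gq; have [|n _] := qcl G 0%N; first exact: open_nbhs_nbhs.
  by have [] := mP n.
have pq : p != q by apply/eqP => pq; apply: nGq; rewrite -pq.
move: hY; rewrite open_hausdorff => /(_ p q pq).
move=> [[W V] /= [/set_mem Wp /set_mem Vq] [oW oV /eqP WV0]].
(* The code [j] of this trace is separated, so the subsequence eventually stays in [(WV j).1], yet
   it must meet the disjoint neighbourhood [(WV j).2] of [q]. *)
have [C [QC Cq CV]] := Qnet V q oV Vq.
pose j := code (C `&` K).
have [oWj oVj Wjp WVj0 Vj] := WP j.
have Vjq : (WV j).2 q.
  apply: (Vj _ C) => //; exists C; split => //; exists W, V; split => //.
have [|n jn Vn] := qcl (WV j).2 j; first exact: open_nbhs_nbhs.
have [nm _] := mP n; have [_ /(_ j) Wn] := sP (m n).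
have : ((WV j).1 `&` (WV j).2) (y (s (m n))).
  by split => //; apply: Wn; exact: leq_trans nm.
by rewrite WVj0.
Qed.

Theorem theorem5p14 (X Y : topologicalType) (f : X -> Y)
    (hX : hausdorff_space X) (hY : hausdorff_space Y)
    (f_cont : continuous f) (f_surj : set_surj [set: X] [set: Y] f)
    (f_closed : closed_map f) (f_seq : sequence_covering f)
    (X_net : exists P : set (set X), sigma_point_discrete P /\ k_network P) :
  exists Q : set (set Y), sigma_point_discrete Q /\ k_network Q.
Proof.
have [P [[F [PF Fpd]] Pnet]] := X_net.
pose Q := [set f @` B | B in P]; exists Q.
have QE : Q = \bigcup_n [set f @` B | B in F n].
  rewrite /Q PF predeqE => C; split => [[B [n _ FB] <-]|[n _ [B FB <-]]].
    by exists n => //; exists B.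
  by exists B => //; exists n.
have Qpd n : point_discrete [set f @` B | B in F n] id.
  exact: point_discrete_image.
split; first by exists (fun n => [set f @` B | B in F n]).
have openf U : open U -> open (f @^-1` U).
  by move=> oU; apply: open_comp => // x _; exact: f_cont.
have Qpnet U z : open U -> U z -> exists C, [/\ Q C, C z & C `<=` U].
  move=> oU Uz; have [x _ fx] := f_surj z I.
  have xU : [set x] `<=` f @^-1` U by move=> _ ->; rewrite /= fx.
  have [P' [_ P'P xP' P'U]] := Pnet _ _ (@compact_set1 _ x) (openf U oU) xU.
  have [B P'B Bx] := xP' x erefl.
  exists (f @` B); split; first by exists B => //; exact: P'P.
    by exists x.
  by move=> _ [x' Bx' <-]; apply: P'U; exists B.
move=> K U Kc oU KU.
have Qtr : countable [set C `&` K | C in Q].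
  have -> : [set C `&` K | C in Q] =
      \bigcup_n [set C `&` K | C in [set f @` B | B in F n]].
    rewrite QE predeqE => T; split => [[C [n _ FC] <-]|[n _ [C FC <-]]].
      by exists n => //; exists C.
    by exists C => //; exists n.
  apply: bigcup_countable => [|n _]; first exact: countableP.
  exact: point_discrete_compact_trace.
have /countable_injP [code codeinj] := Qtr.
pose codes j C := [/\ Q C, C `<=` U & code (C `&` K) = j].
have repP (j : nat) : exists C, (exists C', codes j C') -> codes j C.
  have [[C ?]|nC] := pselect (exists C, codes j C); first by exists C.
  by exists set0.
have [rep {}repP] := choice repP.
have repE C : Q C -> C `<=` U ->
    [/\ Q (rep (code (C `&` K))), rep (code (C `&` K)) `<=` U &
        C `&` K = rep (code (C `&` K)) `&` K].
  move=> QC CU; have [|QD DU De] := repP (code (C `&` K)); first by exists C.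
  split => //; apply: codeinj; rewrite ?De //; apply/mem_set; first by exists C.
  by eexists; first exact: QD.
(* One representative per trace keeps [R n] finite; the intersection discards the arbitrary values
   of [rep] at unrealised codes. *)
pose R n := [set C | Q C /\ C `<=` U] `&` rep @` [set j | (j < n)%N].
have [[n Kn]|ncover] := pselect (exists n, K `<=` \bigcup_(C in R n) C).
  exists (R n); split => //.
  - by apply: finite_setIr; apply: finite_image; exact: finite_II.
  - by move=> C [[]].
  - by move=> z [C [[_ CU] _] /CU].
have yP n : exists z, K z /\ ~ (\bigcup_(C in R n) C) z.
  apply: contrapT => nex; apply: ncover; exists n => z Kz.
  by apply: contrapT => nz; apply: nex; exists z.
have [y {}yP] := choice yP.
have [|p [s [sn ysp]]] := countable_network_subsequence _ _ _ y hY Qpnet Qtr Kc.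
  by move=> n; have [] := yP n.
have [|x [[l xl] fx]] := f_seq (y \o s); first by exists p.
have fl : f l = p.
  apply: (cvg_unique hY _ ysp); rewrite /=.
  have <- : f \o x = y \o s by apply/funext.
  by apply: continuous_cvg => //; exact: f_cont.
have Up : U p.
  apply: KU; apply: (compact_closed hY Kc) => V /ysp [N _ NV].
  by exists (y (s N)); split; [have [] := yP (s N) | exact: (NV N (leqnn N))].
have [|N _ NU] := xl (f @^-1` U).
  by apply: open_nbhs_nbhs; split; [exact: openf | rewrite /= fl].
have [|P' [P'fin P'P xP' P'U]] := Pnet _ _
    (cvg_seq_compact _ _ _ [set n | (N <= n)%N] xl) (openf U oU).
  by move=> _ [->|[n Nn <-]]; [rewrite /= fl | exact: NU].
have [M Mmax] : exists M, forall B, P' B -> (code (f @` B `&` K) < M)%N.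
  have /finite_seqP [r rE] := P'fin.
  exists (\max_(B <- r) code (f @` B `&` K)).+1 => B P'B.
  rewrite ltnS; apply: leq_bigmax_seq => //.
  by move: P'B; rewrite rE.
(* [N] puts [x k] in the compact tail; [M], with [k <= s k], puts the representative of its image
   set in [R (s k)], which [y (s k)] avoids. *)
pose k := maxn N M.
have [B P'B Bx] : (\bigcup_(B in P') B) (x k).
  by apply: xP'; right; exists k => //=; rewrite leq_maxl.
have [Kyk nyk] := yP (s k); exfalso; apply: nyk.
have fBU : f @` B `<=` U by move=> _ [z Bz <-]; apply: P'U; exists B.
have [|QD DU De] := repE (f @` B) _ fBU; first by exists B => //; exact: P'P.
set D := rep _ in QD DU De.
exists D.
  split => //; exists (code (f @` B `&` K)) => //=.
  by rewrite (leq_trans (Mmax B P'B)) // (leq_trans _ (sn k)) // leq_maxr.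
have : (f @` B `&` K) (y (s k)).
  by split => //; exists (x k) => //; exact: fx.
by rewrite De => -[].
Qed.
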